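(* Let $M$ be a matroid that admits a cycle system $\mathcal{C}$. Then $M$ is binary, i.e. representable over the field $\mathbb{F}_2$.
   Context: Matroids are on finite ground sets; $E(M)$ is the ground set and $r(M)$ the rank. A set is dependent if it is not independent. A cycle of $M$ is a subset of $E(M)$ that can be expressed as a union of circuits. The corank of $M$ is $g=|E(M)|-r(M)$. For subsets $A_1,\dots,A_k$ of a set $E$ and $S\subseteq[k]=\{1,\dots,k\}$, the unique union $\mathcal{A}_S=\ast\{A_i: i\in S\}$ is the set of elements of $E$ that belong to exactly one of the sets $A_i$, $i\in S$. A cycle system on a matroid $M$ of corank $g$ is a collection $\mathcal{C}=\{C_1,\dots,C_g\}$ of $g$ cycles of $M$ such that for every nonempty $S\subseteq[g]$ the unique union $\mathcal{C}_S=\ast\{C_i:i\in S\}$ is dependent in $M$. *)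

(* Defs.v *)
From HB Require Import structures.
From mathcomp Require Import all_boot all_order all_algebra.

Set Implicit Arguments.
Unset Strict Implicit.
Unset Printing Implicit Defensive.

(* A matroid whose ground set is the whole finite type [T]. *)
Record matroid (T : finType) := Matroid {
  indep : pred {set T};
  indep0 : indep set0;
  indep_sub : forall A B : {set T}, A \subset B -> indep B -> indep A;
  indep_aug : forall A B : {set T}, indep A -> indep B -> #|A| < #|B| ->
    exists2 x, x \in B :\: A & indep (x |: A)
}.

Definition dependent (T : finType) (M : matroid T) (A : {set T}) : bool :=
  ~~ indep M A.

Definition circuit (T : finType) (M : matroid T) (A : {set T}) : bool :=
  minset (dependent M) A.

(* The empty union is allowed, so [set0] is a cycle. *)
Definition is_cycle (T : finType) (M : matroid T) (A : {set T}) : Prop :=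
  exists2 P : {set {set T}},
    (forall X : {set T}, X \in P -> circuit M X) & A = cover P.

Definition mrank (T : finType) (M : matroid T) : nat :=
  \max_(A : {set T} | indep M A) #|A|.

Definition corank (T : finType) (M : matroid T) : nat := #|T| - mrank M.

Definition unique_union (T I : finType) (A : I -> {set T}) (S : {set I}) :
    {set T} :=
  [set x | #|[set i in S | x \in A i]| == 1].

(* The [C i] are necessarily distinct: [set0] is independent, hence so would be
   the unique union of two equal members. *)
Definition cycle_system (T : finType) (M : matroid T)
    (C : 'I_(corank M) -> {set T}) : Prop :=
  (forall i, is_cycle M (C i)) /\
  (forall S : {set 'I_(corank M)}, S != set0 -> dependent M (unique_union C S)).
Arguments cycle_system {T} M C.

(* [free] is applied to the family of the [v x], x in A, with repetitions:
   parallel elements may be represented by equal vectors. *)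
Definition representable (F : fieldType) (T : finType) (M : matroid T) : Prop :=
  exists (n : nat) (v : T -> 'rV[F]_n),
    forall A : {set T}, indep M A = free [seq v x | x in A].

Definition binary (T : finType) (M : matroid T) : Prop := representable 'F_2 M.

(* Main.v *)
Require Import Defs.
From HB Require Import structures.
From mathcomp Require Import all_boot all_order all_algebra.
From mathcomp Require Import zify.

(** The proof goes through the absence of the four-point line U_{2,4} as a
    minor.

    A cycle system rules out U_{2,4}: suppose that contracting an independent
    set Y of size r(M) - 2 leaves four pairwise independent points a, b, c, d.
    Cycle systems behave well under deleting an element e that lies in exactly
    one cycle of a subfamily J, together with that cycle: the remaining cycles
    of J avoid e, so they still form such a family on the smaller set. Delete
    this way for as long as four points survive; each step keeps the excess
    |W| - |J| at most 2 on the current set W of elements. When no deletion is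
    possible, every element of the unique union of J is, modulo Y, a member of
    each four-point line in W. The union is dependent, so it contains three of
    the four points, say a, b, c, and each of them is then alone in its
    parallel class of M / Y, while all other elements of W are loops of M / Y
    or parallel to d. A cycle through a must pass through b or c as well,
    because a is not in the closure of Y and d. But each of a, b, c belongs to
    one cycle only, so a single cycle of J takes all three, and the |J| - 1
    others live on at most |W| - 3 <= |J| - 1 elements, in a part of M whose
    rank modulo Y is 1. This is one cycle too many ([card_cycle_family_le]): a
    family whose unique unions are all dependent has at most as many members
    as there are elements outside an independent set.

    A matroid without U_{2,4} is binary: its independent sets can be recovered
    from one basis B and the bases B - b + x. Indeed in rank 2 the five pairs
    of {b, c, x, y} other than {x, y} decide whether {x, y} is a basis, by
    parallelism, except when all five are bases; then {x, y} is not, for lack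
    of U_{2,4}. So two U_{2,4}-free matroids that agree at B agree at every
    neighbouring basis ([agree_pivot]), hence everywhere. This is applied to M
    and to the linear matroid over the field with two elements whose vectors
    are the incidence vectors of the parts in B of the fundamental circuits;
    the latter has no U_{2,4} because a plane over that field has only three
    nonzero vectors. *)

Set Implicit Arguments.
Unset Strict Implicit.
Unset Printing Implicit Defensive.

(** * Bases *)

Definition basis (T : finType) (M : matroid T) (A : {set T}) : bool :=
  indep M A && (#|A| == mrank M).

Lemma indep_card_le (T : finType) (M : matroid T) (A : {set T}) :
  indep M A -> #|A| <= mrank M.
Proof. by move=> iA; apply: (leq_bigmax_cond (F := fun A : {set T} => #|A|)). Qed.

Lemma basis_card (T : finType) (M : matroid T) A : basis M A -> #|A| = mrank M.
Proof. by case/andP=> _ /eqP. Qed.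

Lemma basis_exists (T : finType) (M : matroid T) : exists B, basis M B.
Proof.
have [B iB maxB] : {B : {set T} | indep M B & mrank M = #|B|}.
  by apply: eq_bigmax_cond; apply/card_gt0P; exists set0; apply: indep0.
by exists B; rewrite /basis iB maxB eqxx.
Qed.

Lemma indep_extend (T : finType) (M : matroid T) (A B : {set T}) :
    indep M A -> indep M B -> #|A| <= #|B| ->
  exists Z, [/\ indep M Z, A \subset Z, Z \subset A :|: B & #|Z| = #|B|].
Proof.
move=> iA iB; move: {2}(#|B| - #|A|) (leqnn (#|B| - #|A|)) => n.
elim: n A iA => [|n IHn] A iA le_n leAB.
  by exists A; rewrite iA subxx subsetUl; split=> //; lia.
have [/eqP eqAB | ltAB] := boolP (#|A| == #|B|).
  by exists A; rewrite iA subxx subsetUl; split.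
have [|x] := indep_aug iA iB; first by lia.
rewrite inE => /andP[xNA xB] ixA.
have cxA : #|x |: A| = #|A|.+1 by rewrite cardsU1 xNA.
have [||Z [iZ sAZ sZ cZ]] := IHn _ ixA; [lia | lia |].
exists Z; split=> //; first exact: subset_trans (subsetUr _ _) sAZ.
apply: subset_trans sZ _; rewrite !subUset sub1set inE xB orbT subsetUl.
exact: subsetUr.
Qed.

Lemma basis_extend (T : finType) (M : matroid T) (A : {set T}) :
  indep M A -> exists2 B, basis M B & A \subset B.
Proof.
move=> iA; have [B0 /andP[iB0 /eqP cB0]] := basis_exists M.
have [|Z [iZ sAZ _ cZ]] := indep_extend iA iB0.
  by rewrite cB0 indep_card_le.
by exists Z; rewrite // /basis iZ cZ cB0 eqxx.
Qed.

Lemma eq_indep_basis (T : finType) (M N : matroid T) :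
  basis M =1 basis N -> indep M =1 indep N.
Proof.
move=> eqb A; apply/idP/idP => /basis_extend[B].
  by rewrite eqb => /andP[iB _] sAB; apply: indep_sub iB.
by rewrite -eqb => /andP[iB _] sAB; apply: indep_sub iB.
Qed.

(** The size condition on Y makes a basis of the form Y + x + y
    automatically have x and y distinct and outside Y, so pairs of independent
    points of the rank 2 contraction M / Y are handled as bases of M. *)
Lemma basis_pair_distinct (T : finType) (M : matroid T) (Y : {set T}) x y :
    #|Y|.+2 = mrank M -> basis M (x |: (y |: Y)) ->
  [/\ x != y, x \notin Y & y \notin Y].
Proof.
move=> cY /andP[_]; rewrite !cardsU1 -cY !inE negb_or.
by case: (x == y) (x \in Y) (y \in Y) => [] [] [] // /eqP /= ?; exfalso; lia.
Qed.

(** Transitivity of parallelism in M / Y, in contrapositive form: the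
    hypothesis on e only says that x is not a loop of M / Y, and a nonloop
    cannot be parallel to both of two nonparallel points. *)
Lemma basis_pair_trans (T : finType) (M : matroid T) (Y : {set T}) x e a b :
    #|Y|.+2 = mrank M -> basis M (x |: (e |: Y)) -> basis M (a |: (b |: Y)) ->
  basis M (x |: (a |: Y)) || basis M (x |: (b |: Y)).
Proof.
move=> cY bxe bab; have [_ xNY _] := basis_pair_distinct cY bxe.
have ixY : indep M (x |: Y).
  case/andP: bxe => ixe _; apply: indep_sub ixe; rewrite setUCA.
  exact: subsetUr.
case/andP: (bab) => iab /eqP cab.
have [|z] := indep_aug ixY iab; first by rewrite cab cardsU1 xNY -cY.
rewrite !inE negb_or => /andP[/andP[zNx zNY]].
rewrite (negbTE zNY) orbF => zab izx.
have bxz : basis M (x |: (z |: Y)).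
  by rewrite setUCA /basis izx !cardsU1 !inE negb_or zNx zNY xNY -cY !add1n eqxx.
by case/orP: zab => /eqP <-; rewrite bxz ?orbT.
Qed.

(** The restriction of M / Y to a, b, c, d is the uniform matroid U_{2,4}.  This
    reading supposes that Y has size two less than the rank. *)
Definition U24_minor (T : finType) (M : matroid T) (Y : {set T}) a b c d : bool :=
  pairwise (fun x y => basis M (x |: (y |: Y))) [:: a; b; c; d].

Lemma U24_minorP (T : finType) (M : matroid T) (Y : {set T}) a b c d :
  reflect ([/\ basis M (a |: (b |: Y)), basis M (a |: (c |: Y))
               & basis M (a |: (d |: Y))] /\
           [/\ basis M (b |: (c |: Y)), basis M (b |: (d |: Y))
               & basis M (c |: (d |: Y))])
          (U24_minor M Y a b c d).
Proof.
rewrite /U24_minor /= !andbT; apply: (iffP and3P) => [[/and3P[? ? ?] /andP[? ?] ?] | ].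
  by [].
by case=> -[-> -> ->] [-> -> ->].
Qed.

(** * Matroids determined by the exchanges at one basis *)

(** Contracting an independent set of corank two and deleting reaches
    every U_{2,4} minor, so this is the usual excluded-minor condition. *)
Definition U24_free (T : finType) (M : matroid T) : Prop :=
  forall (Y : {set T}) a b c d, #|Y|.+2 = mrank M -> ~~ U24_minor M Y a b c d.

(** M and N have the same fundamental circuits with respect to B: the
    circuit of x in B + x consists of x and the b for which B - b + x is a
    basis. *)
Definition agree_at (T : finType) (M N : matroid T) (B : {set T}) : Prop :=
  [/\ basis M B, basis N B &
    forall b x, b \in B -> basis M (x |: B :\ b) = basis N (x |: B :\ b)].

Lemma agree_at_sym (T : finType) (M N : matroid T) B :
  agree_at M N B -> agree_at N M B.
Proof. by case=> bM bN e; split=> // b x bB; rewrite e. Qed.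

(** One direction of the recovery of the pair x, y from the five other pairs of
    b, c, x, y.  When some pair with x or y is dependent, the pair x, y
    is decided by replacing a point by a parallel one; when all five are
    bases of M, a sixth would give U_{2,4}. *)
Lemma agree_pair_le (T : finType) (M N : matroid T) (Y : {set T}) b c x y :
    U24_free M -> #|Y|.+2 = mrank M -> #|Y|.+2 = mrank N ->
    basis M (b |: (c |: Y)) -> basis N (x |: (c |: Y)) ->
    basis M (x |: (b |: Y)) = basis N (x |: (b |: Y)) ->
    basis M (x |: (c |: Y)) = basis N (x |: (c |: Y)) ->
    basis M (y |: (b |: Y)) = basis N (y |: (b |: Y)) ->
    basis M (y |: (c |: Y)) = basis N (y |: (c |: Y)) ->
  basis M (x |: (y |: Y)) -> basis N (x |: (y |: Y)).
Proof.
move=> fM cM cN Mbc Nxc exb exc eyb eyc Mxy.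
have Mxc : basis M (x |: (c |: Y)) by rewrite exc.
have Myx : basis M (y |: (x |: Y)) by rewrite setUCA.
have [Myc | MNyc] := boolP (basis M (y |: (c |: Y))); last first.
  (* In N, y is a nonloop parallel to c, and replaces c in the pair x, c. *)
  have := basis_pair_trans cM Myx Mbc; rewrite (negbTE MNyc) orbF eyb => Nyb.
  have := basis_pair_trans cN Nyb Nxc.
  by rewrite -eyc (negbTE MNyc) orbF setUCA.
have Nyc : basis N (y |: (c |: Y)) by rewrite -eyc.
have [Myb | MNyb] := boolP (basis M (y |: (b |: Y))); last first.
  (* In both matroids, y is parallel to b, and replaces b in the pair x, b. *)
  have := basis_pair_trans cM Mbc Myx.
  rewrite setUCA (negbTE MNyb) /= setUCA exb => Nxb.
  have := basis_pair_trans cN Nyc Nxb.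
  by rewrite -eyb (negbTE MNyb) orbF setUCA.
have [Mxb | MNxb] := boolP (basis M (x |: (b |: Y))).
  have /U24_minorP[] := fM Y b c x y cM; split; split=> //; by rewrite setUCA.
(* In N, x is parallel to b, and replaces b in the pair y, b. *)
have Nyb : basis N (y |: (b |: Y)) by rewrite -eyb.
have := basis_pair_trans cN Nxc Nyb.
by rewrite -exb (negbTE MNxb) orbF.
Qed.

(** For c other than x, the set y + (x + B - b) - c is two exchanges away from
    B, so it is one of the six pairs on b, c, x, y over Y = B - b - c; the
    other five are B and single exchanges at B. *)
Lemma agree_pivot (T : finType) (M N : matroid T) B b x :
    U24_free M -> U24_free N -> agree_at M N B -> b \in B ->
    basis M (x |: B :\ b) ->
  agree_at M N (x |: B :\ b).
Proof.
move=> fM fN [bMB bNB eB] bB bMx.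
have bNx : basis N (x |: B :\ b) by rewrite -eB.
have eR : mrank M = mrank N by rewrite -(basis_card bMB) (basis_card bNB).
split=> // c y; rewrite in_setU1.
have cBb : #|B :\ b|.+1 = mrank M by rewrite -(basis_card bMB) (cardsD1 b B) bB.
have xNBb : x \notin B :\ b.
  by move: (basis_card bMx); rewrite cardsU1 -cBb; case: (x \notin _) => //; lia.
have [-> _|cNx /= cBb1] := eqVneq c x; first by rewrite setU1K // eB.
set Y := B :\ b :\ c.
have eY : (x |: B :\ b) :\ c = x |: Y.
  apply/setP=> z; rewrite !inE; have [->|] := eqVneq z x; last by [].
  by rewrite eq_sym cNx.
have cB : c \in B by move: cBb1; rewrite inE => /andP[].
have cNb : c != b by move: cBb1; rewrite !inE => /andP[].
have YB : B = b |: (c |: Y) by rewrite setD1K // setD1K.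
have YBb : B :\ b = c |: Y by rewrite setD1K.
have YBc : B :\ c = b |: Y.
  apply/setP=> z; rewrite !inE; have [->|] := eqVneq z b; last by [].
  by rewrite eq_sym cNb bB.
have cY : #|Y|.+2 = mrank M.
  by rewrite -cBb YBb cardsU1 !inE eqxx.
have cYN : #|Y|.+2 = mrank N by rewrite -eR.
have eb z : basis M (z |: (b |: Y)) = basis N (z |: (b |: Y)).
  by rewrite -YBc eB.
have ec z : basis M (z |: (c |: Y)) = basis N (z |: (c |: Y)).
  by rewrite -YBb eB.
rewrite eY setUCA; apply/idP/idP; rewrite YBb in bMx bNx; rewrite YB in bMB bNB.
  exact: (agree_pair_le (b := b) (c := c)).
by apply: (agree_pair_le (b := b) (c := c)).
Qed.

(** Pivoting moves the point of agreement from B to Z one exchange at a time,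
    so agreement eventually holds at Z itself. *)
Lemma agree_basis (T : finType) (M N : matroid T) B Z :
    U24_free M -> U24_free N -> agree_at M N B -> basis M Z -> basis N Z.
Proof.
move=> fM fN; move: {2}#|Z :\: B| (leqnn #|Z :\: B|) => n.
elim: n B => [|n IHn] B leZB aB bZ; have [bMB bNB _] := aB.
  suff -> : Z = B by [].
  apply/eqP; rewrite eqEcard (basis_card bZ) (basis_card bMB) leqnn andbT.
  by rewrite -setD_eq0 -cards_eq0 -leqn0.
have [sBZ | /subsetPn[b bB bNZ]] := boolP (B \subset Z).
  suff <- : B = Z by [].
  by apply/eqP; rewrite eqEcard (basis_card bZ) (basis_card bMB) leqnn sBZ.
have cBb : #|B :\ b|.+1 = mrank M by rewrite -(basis_card bMB) (cardsD1 b B) bB.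
have iBb : indep M (B :\ b).
  by case/andP: bMB => iB _; apply: indep_sub iB; apply: subsetDl.
have [iZ _] := andP bZ.
have [|x] := indep_aug iBb iZ; first by rewrite (basis_card bZ); lia.
rewrite inE => /andP[xNBb xZ] ixB.
have bx : basis M (x |: B :\ b) by rewrite /basis ixB cardsU1 xNBb -cBb add1n eqxx.
apply: (IHn (x |: B :\ b)) => //; last exact: agree_pivot.
have xNB : x \notin B.
  by apply: contra xNBb => xB; rewrite !inE xB andbT; apply: contra bNZ => /eqP<-.
rewrite -ltnS; apply: leq_trans leZB.
have -> : Z :\: (x |: B :\ b) = (Z :\: B) :\ x.
  apply/setP=> z; rewrite !inE !negb_or !negb_and negbK.
  have [->|_] := eqVneq z b; first by rewrite (negbTE bNZ) !andbF.
  by rewrite /= -andbA.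
by rewrite [leqRHS](cardsD1 x) !inE xNB xZ.
Qed.

Lemma agree_indep (T : finType) (M N : matroid T) B :
  U24_free M -> U24_free N -> agree_at M N B -> indep M =1 indep N.
Proof.
move=> fM fN aB; apply: eq_indep_basis => Z; apply/idP/idP.
  exact: agree_basis aB.
exact: agree_basis (agree_at_sym aB).
Qed.

(** * Cycle systems exclude U_{2,4} *)

Lemma unique_unionP (T I : finType) (C : I -> {set T}) (J : {set I}) e :
    e \in unique_union C J ->
  exists i, [/\ i \in J, e \in C i & forall j, j \in J -> e \in C j -> j = i].
Proof.
rewrite inE => /cards1P[i Ei].
have in_i j : (j \in J) && (e \in C j) = (j == i).
  by move/setP/(_ j): Ei; rewrite !inE.
have /andP[iJ eCi] : (i \in J) && (e \in C i) by rewrite in_i.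
by exists i; split=> // j jJ eCj; apply/eqP; rewrite -in_i jJ.
Qed.

Lemma unique_union_sub (T I : finType) (C : I -> {set T}) (J : {set I})
    (X : {set T}) :
  (forall j, j \in J -> C j \subset X) -> unique_union C J \subset X.
Proof.
move=> sCX; apply/subsetP=> e /unique_unionP[i [iJ eC _]].
exact: (subsetP (sCX i iJ)).
Qed.

Lemma dependent_subset (T : finType) (M : matroid T) (A B : {set T}) :
  dependent M A -> indep M B -> exists2 e, e \in A & e \notin B.
Proof.
move=> dA iB; apply/subsetPn; apply: contra dA => sAB; exact: indep_sub iB.
Qed.

(** The deletion step: when e lies in only one member of a family, dropping
    that member leaves a family that avoids e. *)
Lemma remove_cycle_sub (T I : finType) (C : I -> {set T}) (J : {set I}) e i
    (W Y : {set T}) :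
    (forall j, j \in J -> C j \subset W :|: Y) ->
    (forall j, j \in J -> e \in C j -> j = i) ->
  forall j, j \in J :\ i -> C j \subset W :\ e :|: Y.
Proof.
move=> sC ui j; rewrite !inE => /andP[jNi jJ].
apply/subsetP=> x xC; have := subsetP (sC j jJ) x xC.
rewrite !inE; have [xe | //] := eqVneq x e.
by case/eqP: jNi; apply: ui; rewrite // -xe.
Qed.

(** The unique union of the family escapes the independent set K at some e,
    which lies in a single member; removing e with that member and repeating
    matches the members to distinct elements of V. *)
Lemma card_cycle_family_le (T I : finType) (M : matroid T) (C : I -> {set T})
    (hU : forall S : {set I}, S != set0 -> dependent M (unique_union C S))
    (K : {set T}) (J : {set I}) (V : {set T}) :
  indep M K -> (forall j, j \in J -> C j \subset V :|: K) -> #|J| <= #|V|.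
Proof.
move=> iK; move: {2}#|V| (leqnn #|V|) => n.
elim: n V J => [|n IHn] V J; have [->|J0] := eqVneq J set0;
  rewrite ?cards0 // => leV sC.
  move: leV; rewrite leqn0 cards_eq0 => /eqP V0.
  have := hU J J0; rewrite /dependent (indep_sub _ iK) //.
  by apply: unique_union_sub => j /sC; rewrite V0 set0U.
have [e eU eNK] := dependent_subset (hU J J0) iK.
have [i [iJ eCi ui]] := unique_unionP eU.
have eV : e \in V.
  by have := subsetP (sC i iJ) e eCi; rewrite inE (negbTE eNK) orbF.
rewrite (cardsD1 i) iJ (cardsD1 e V) eV; apply: IHn.
  by move: leV; rewrite (cardsD1 e) eV.
exact: remove_cycle_sub ui.
Qed.

(** A cycle cannot leave the closure of K at a single element, as that
    element would be a coloop of the restriction of M to the cycle. *)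
Lemma cycle_second_exit (T : finType) (M : matroid T) (A K : {set T}) a :
    is_cycle M A -> a \in A -> basis M (a |: K) -> a \notin K ->
  exists2 z, z \in A :\ a & basis M (z |: K).
Proof.
case=> P cP -> /bigcupP[X XP aX] /andP[iaK /eqP caK] aNK.
have /minsetP[dX minX] := cP X XP.
have iXa : indep M (X :\ a).
  apply: contraT => dXa; have := minX _ dXa (subsetDl _ _).
  by move/setP/(_ a); rewrite !inE eqxx aX.
have iK : indep M K by apply: indep_sub iaK; apply: subsetUr.
have [|Z [iZ sXZ sZ cZ]] := indep_extend iXa iaK; first by rewrite caK indep_card_le.
have aNZ : a \notin Z.
  apply/negP=> aZ; case/negP: dX; apply: indep_sub iZ.
  by rewrite -(setD1K aX) subUset sub1set aZ.
have [|z] := indep_aug iK iZ; first by rewrite cZ cardsU1 aNK.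
rewrite inE => /andP[zNK zZ] izK; exists z.
  have := subsetP sZ z zZ; rewrite !inE (negbTE zNK) orbF.
  have [za|_ /=] := eqVneq z a; first by rewrite -za zZ in aNZ.
  by rewrite orbF => zX; apply/bigcupP; exists X.
by rewrite /basis izK cardsU1 zNK -caK cardsU1 aNK eqxx.
Qed.

Lemma U24_minor_uniq (T : finType) (M : matroid T) (Y : {set T}) a b c d :
    #|Y|.+2 = mrank M -> U24_minor M Y a b c d ->
  uniq [:: a; b; c; d] && all [predC Y] [:: a; b; c; d].
Proof.
move=> cY /U24_minorP[[ab ac ad] [bc bd cd]].
have [nab aNY bNY] := basis_pair_distinct cY ab.
have [nac _ cNY] := basis_pair_distinct cY ac.
have [nad _ dNY] := basis_pair_distinct cY ad.
have [nbc _ _] := basis_pair_distinct cY bc.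
have [nbd _ _] := basis_pair_distinct cY bd.
have [ncd _ _] := basis_pair_distinct cY cd.
by rewrite /= !inE !negb_or nab nac nad nbc nbd ncd aNY bNY cNY dNY.
Qed.

Definition has_U24_minor (T : finType) (M : matroid T) (Y W : {set T}) : Prop :=
  exists a b c d, [/\ a \in W, b \in W, c \in W, d \in W & U24_minor M Y a b c d].

Lemma U24_minor_card (T : finType) (M : matroid T) (Y W : {set T}) a b c d :
    #|Y|.+2 = mrank M ->
    [/\ a \in W, b \in W, c \in W, d \in W & U24_minor M Y a b c d] ->
  3 < #|W|.
Proof.
move=> cY [aW bW cW dW /(U24_minor_uniq cY)/andP[uq _]].
apply/card_geqP; exists [:: a; b; c; d]; split=> // x.
by rewrite !inE; case/or4P=> /eqP->.
Qed.

(** Rotations suffice to put any one of the four points last. *)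
Lemma U24_minor_rot (T : finType) (M : matroid T) (Y : {set T}) a b c d :
  U24_minor M Y a b c d = U24_minor M Y b c d a.
Proof.
by apply/U24_minorP/U24_minorP=> -[[? ? ?] [? ? ?]]; split; split; rewrite // setUCA.
Qed.

(** The terminal configuration of the deletion process: if no element of the
    unique union outside Y can be deleted without destroying all four-point
    lines in W, then the union contains at most two of the points of each
    line. Three such points a, b, c would be alone in their parallel classes
    of M / Y, forcing one cycle through all of them and leaving the other
    cycles on too few elements. *)
Lemma unique_union_lt3_of_U24 (T I : finType) (M : matroid T) (C : I -> {set T})
    (hC : forall i, is_cycle M (C i))
    (hU : forall S : {set I}, S != set0 -> dependent M (unique_union C S))
    (Y W : {set T}) (J : {set I}) a b c d :
    #|Y|.+2 = mrank M -> #|W| <= #|J|.+2 ->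
    (forall j, j \in J -> C j \subset W :|: Y) ->
    (forall e, e \in unique_union C J -> e \notin Y -> ~ has_U24_minor M Y (W :\ e)) ->
    [/\ a \in W, b \in W, c \in W, d \in W & U24_minor M Y a b c d] ->
    a \in unique_union C J -> b \in unique_union C J -> c \in unique_union C J ->
  False.
Proof.
move=> cY leW sC no_U24 [aW bW cW dW qd] aU bU cU.
have := U24_minor_uniq cY qd; rewrite /= !inE !negb_or !andbT.
case/andP=> /and3P[/and3P[nab nac nad] /andP[nbc nbd] ncd] /and4P[aNY bNY cNY dNY].
have [[ab ac ad] [bc bd cd]] := U24_minorP _ _ _ _ _ _ qd.
(* If x were independent of d over Y, it would be parallel to at most one of
   a, b, c, and could replace that one in the line. *)
have parallel x : x \in W :|: Y -> x != a -> x != b -> x != c ->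
    basis M (x |: (d |: Y)) = false.
  move=> xWY xa xb xc; apply/negP=> xd.
  have [_ xNY _] := basis_pair_distinct cY xd.
  have xW : x \in W by move: xWY; rewrite inE (negbTE xNY) orbF.
  have no_U24_x e y z : e \in unique_union C J -> e \notin Y -> x != e ->
      y != e -> z != e -> d != e -> y \in W -> z \in W -> basis M (y |: (z |: Y)) ->
      basis M (y |: (d |: Y)) -> basis M (z |: (d |: Y)) ->
      ~~ (basis M (x |: (y |: Y)) && basis M (x |: (z |: Y))).
    move=> eU eNY xe ye ze de yW zW yz yd zd; apply/negP=> /andP[xy xz].
    apply: (no_U24 e eU eNY); exists x, y, z, d.
    by rewrite !inE xe ye ze de xW yW zW dW; split=> //; apply/U24_minorP.
  have := basis_pair_trans cY xd ab; have := basis_pair_trans cY xd ac.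
  have := basis_pair_trans cY xd bc.
  have := no_U24_x c a b cU cNY xc nac nbc _ aW bW ab ad bd; rewrite eq_sym => /(_ ncd).
  have := no_U24_x b a c bU bNY xb nab _ _ aW cW ac ad cd.
  rewrite ![_ == b]eq_sym => /(_ nbc nbd).
  have := no_U24_x a b c aU aNY xa _ _ _ bW cW bc bd cd.
  rewrite ![_ == a]eq_sym => /(_ nab nac nad).
  by do 3 case: (basis M (x |: _)).
(* A cycle through one of a, b, c contains a second one, since everything else
   in W lies in the closure of Y and d. *)
have meets u i : u \in [:: a; b; c] -> i \in J -> u \in C i ->
    exists z, [&& z != u, z \in C i & z \in [:: a; b; c]].
  move=> uabc iJ uC.
  have [ud uNd] : basis M (u |: (d |: Y)) /\ u \notin d |: Y.
    move: uabc; rewrite !inE negb_or.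
    by case/or3P=> /eqP->; rewrite ?nad ?nbd ?ncd ?aNY ?bNY ?cNY.
  have [z] := cycle_second_exit (hC i) uC ud uNd.
  rewrite 2!inE => /andP[zu zC] zd; exists z; rewrite zu zC !inE /=.
  apply: contraT; rewrite !negb_or => /and3P[za zb zc].
  by rewrite -(parallel z _ za zb zc) // (subsetP (sC i iJ)).
have [i [iJ aCi uia]] := unique_unionP aU.
have [ib [ibJ bCi uib]] := unique_unionP bU.
have [ic [icJ cCi uic]] := unique_unionP cU.
have [eib eic] : ib = i /\ ic = i.
  have [|||z1 /and3P[z1a z1C z1abc]] := meets a i; rewrite ?inE ?eqxx //.
  have [|||z2 /and3P[z2b z2C z2abc]] := meets b ib; rewrite ?inE ?eqxx ?orbT //.
  have [|||z3 /and3P[z3c z3C z3abc]] := meets c ic; rewrite ?inE ?eqxx ?orbT //.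
  move: z1abc z2abc z3abc; rewrite !inE (negbTE z1a) (negbTE z2b) (negbTE z3c) /=.
  rewrite orbF.
  case/orP=> /eqP e1; case/orP=> /eqP e2; case/orP=> /eqP e3;
    rewrite e1 in z1C; rewrite e2 in z2C; rewrite e3 in z3C;
    try have := uia _ ibJ z2C; try have := uia _ icJ z3C;
    try have := uib _ iJ z1C; try have := uib _ icJ z3C;
    try have := uic _ iJ z1C; try have := uic _ ibJ z2C; split; congruence.
subst ib ic.
pose V := W :\ a :\ b :\ c.
(* The other cycles avoid a, b, c; measured against the independent set Y + d
   they occupy only the elements of V other than d. *)
have sCV j : j \in J :\ i -> C j \subset V :\ d :|: (d |: Y).
  rewrite inE => /andP; rewrite inE => -[jNi jJ]; apply/subsetP=> x xC.
  have xN (u : T) : (forall j, j \in J -> u \in C j -> j = i) -> x != u.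
    by move=> ui; apply: contra jNi => /eqP xu; rewrite (ui j) // -xu.
  have := subsetP (sC j jJ) x xC.
  by rewrite !inE (xN a uia) (xN b uib) (xN c uic); case: (x == d).
have idY : indep M (d |: Y).
  by case/andP: ad => iad _; apply: indep_sub iad; apply: subsetUr.
have cVd : #|W| = #|V :\ d|.+4.
  rewrite (cardsD1 a W) aW (cardsD1 b) (cardsD1 c) (cardsD1 d (_ :\ c)) !inE bW cW dW.
  by rewrite !(eq_sym _ c) !(eq_sym _ b) !(eq_sym _ a) nab nac nad nbc nbd ncd.
have : #|W| <= #|V :\ d|.+3.
  apply: leq_trans leW _; rewrite (cardsD1 i) iJ !ltnS.
  exact: (card_cycle_family_le hU idY sCV).
by rewrite cVd ltnn.
Qed.

(** Stated for subfamilies J on subsets W so that the deletion step is an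
    induction; the bound on W says that the nullity of M restricted to W and Y
    is at most the number of cycles left once W contains a line. *)
Lemma cycle_family_no_U24 (T I : finType) (M : matroid T) (C : I -> {set T})
    (hC : forall i, is_cycle M (C i))
    (hU : forall S : {set I}, S != set0 -> dependent M (unique_union C S))
    (Y W : {set T}) (J : {set I}) :
    #|Y|.+2 = mrank M -> #|W| <= #|J|.+2 ->
    (forall j, j \in J -> C j \subset W :|: Y) -> ~ has_U24_minor M Y W.
Proof.
move=> cY; move: {2}#|J| (leqnn #|J|) => n.
elim: n J W => [|n IHn] J W leJ leW sC [a [b [c [d qW]]]].
  by have := U24_minor_card cY qW; lia.
have [aW bW cW dW qd] := qW.
have J0 : J != set0 by rewrite -card_gt0; have := U24_minor_card cY qW; lia.
have dU := hU J J0.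
have no_U24 e : e \in unique_union C J -> e \notin Y -> ~ has_U24_minor M Y (W :\ e).
  move=> eU eNY; have [i [iJ eCi ui]] := unique_unionP eU.
  have eW : e \in W.
    by have := subsetP (sC i iJ) e eCi; rewrite inE (negbTE eNY) orbF.
  apply: (IHn (J :\ i)); last exact: remove_cycle_sub ui.
    by move: leJ; rewrite (cardsD1 i) iJ.
  by move: leW; rewrite (cardsD1 i J) iJ (cardsD1 e W) eW.
have sU e : e \in unique_union C J -> e \notin Y -> e \in [:: a; b; c; d].
  move=> eU eNY; apply: contraT; rewrite !inE !negb_or => /and4P[ea eb ec ed].
  exfalso; apply: (no_U24 e eU eNY); exists a, b, c, d.
  by rewrite !inE aW bW cW dW ![_ == e]eq_sym ea eb ec ed.
(* A basis omitting two members of the quadruple cannot contain the union. *)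
have two x y u v : basis M (x |: (y |: Y)) -> [:: a; b; c; d] =i [:: x; y; u; v] ->
    (u \in unique_union C J) || (v \in unique_union C J).
  case/andP=> ixy _ eq4; have [e eU] := dependent_subset dU ixy.
  rewrite in_setU1 in_setU1 !negb_or => /and3P[/negbTE ex /negbTE ey eNY].
  have := sU e eU eNY; rewrite eq4 in_cons in_cons in_cons mem_seq1 ex ey /=.
  by case/orP=> /eqP <-; rewrite eU ?orbT.
have core := unique_union_lt3_of_U24 hC hU cY leW sC no_U24.
have [[ab ac ad] [bc bd cd]] := U24_minorP _ _ _ _ _ _ qd.
have qb := qd; rewrite U24_minor_rot in qb; have qc := qb; rewrite U24_minor_rot in qc.
have qa := qc; rewrite U24_minor_rot in qa.
have {ab}ab : (c \in unique_union C J) || (d \in unique_union C J) by exact: two ab _.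
have {ac}ac : (b \in unique_union C J) || (d \in unique_union C J).
  by apply: two ac _ => z; rewrite !inE; do 4 case: (z == _).
have {ad}ad : (b \in unique_union C J) || (c \in unique_union C J).
  by apply: two ad _ => z; rewrite !inE; do 4 case: (z == _).
have {bc}bc : (a \in unique_union C J) || (d \in unique_union C J).
  by apply: two bc _ => z; rewrite !inE; do 4 case: (z == _).
have {bd}bd : (a \in unique_union C J) || (c \in unique_union C J).
  by apply: two bd _ => z; rewrite !inE; do 4 case: (z == _).
have {cd}cd : (a \in unique_union C J) || (b \in unique_union C J).
  by apply: two cd _ => z; rewrite !inE; do 4 case: (z == _).
have [aU | aNU] := boolP (a \in unique_union C J); last first.
  rewrite !(negbTE aNU) /= in bc bd cd.
  exact: (core b c d a).
have [bU | bNU] := boolP (b \in unique_union C J); last first.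
  rewrite !(negbTE bNU) /= in ac ad.
  exact: (core c d a b).
have [cU | cNU] := boolP (c \in unique_union C J).
  exact: (core a b c d).
by rewrite (negbTE cNU) /= in ab; apply: (core d a b c).
Qed.

(** The corank is exactly the number of elements outside Y, less two. *)
Lemma cycle_system_U24_free (T : finType) (M : matroid T)
    (C : 'I_(corank M) -> {set T}) :
  cycle_system M C -> U24_free M.
Proof.
case=> hC hU Y a b c d cY; apply/negP=> qd.
have := U24_minor_uniq cY qd; rewrite /= !andbT => /andP[_ /and4P[aNY bNY cNY dNY]].
apply: (cycle_family_no_U24 (W := ~: Y) (J := setT) hC hU cY).
- by rewrite cardsT card_ord /corank cardsCs setCK -cY; lia.
- by move=> j _; rewrite setUC setUCr subsetT.
- by exists a, b, c, d; rewrite !inE.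
Qed.

(** * Linear matroids over the field with two elements *)

Import GRing.Theory.
Local Open Scope ring_scope.

Lemma perm_enumU1 (T : finType) (A : {set T}) x :
  x \notin A -> perm_eq (enum (x |: A)) (x :: enum A).
Proof.
move=> xNA; apply: uniq_perm; rewrite /= ?enum_uniq ?mem_enum ?xNA //.
by move=> z; rewrite inE !mem_enum !inE.
Qed.

Lemma span_imageU1 (F : fieldType) (V : vectType F) (T : finType) (v : T -> V)
    (A : {set T}) x :
  <<[seq v z | z in x |: A]>>%VS = (<[v x]> + <<[seq v z | z in A]>>)%VS.
Proof.
rewrite -span_cons; apply: eq_span => z; rewrite inE; apply/imageP/idP.
  case=> y; rewrite !inE => /orP[/eqP-> ->|yA ->]; first by rewrite eqxx.
  by rewrite image_f ?orbT.
case/orP=> [/eqP->|/imageP[y yA ->]]; first by exists x; rewrite ?inE ?eqxx.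
by exists y; rewrite ?inE ?yA ?orbT.
Qed.

Lemma free_imageU1 (F : fieldType) (V : vectType F) (T : finType) (v : T -> V)
    (A : {set T}) x : x \notin A ->
  free [seq v z | z in x |: A] =
    (v x \notin <<[seq v z | z in A]>>%VS) && free [seq v z | z in A].
Proof.
by move=> xNA; rewrite (perm_free (perm_map v (perm_enumU1 xNA))) /= free_cons.
Qed.

Definition lin_indep (F : fieldType) (V : vectType F) (T : finType) (v : T -> V)
    (A : {set T}) : bool := free [seq v x | x in A].

Lemma lin_indep0 (F : fieldType) (V : vectType F) (T : finType) (v : T -> V) :
  lin_indep v set0.
Proof. by rewrite /lin_indep /image_mem enum_set0 nil_free. Qed.

Lemma lin_indep_sub (F : fieldType) (V : vectType F) (T : finType) (v : T -> V)
    (A B : {set T}) :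
  A \subset B -> lin_indep v B -> lin_indep v A.
Proof.
move=> sAB; rewrite /lin_indep.
have -> : B = A :|: (B :\: A) by rewrite setDE setUIr setUCr setIT; apply/esym/setUidPr.
have : perm_eq (enum (A :|: (B :\: A))) (enum A ++ enum (B :\: A)).
  apply: uniq_perm; rewrite ?enum_uniq ?cat_uniq //= ?enum_uniq ?andbT /=.
    by apply/hasPn=> z; rewrite !mem_enum inE => /andP[].
  by move=> z; rewrite mem_cat !mem_enum inE.
by move/(perm_map v)/perm_free ->; rewrite map_cat => /catl_free.
Qed.

Lemma lin_indep_aug (F : fieldType) (V : vectType F) (T : finType) (v : T -> V)
    (A B : {set T}) :
    lin_indep v A -> lin_indep v B -> (#|A| < #|B|)%N ->
  exists2 x, x \in B :\: A & lin_indep v (x |: A).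
Proof.
move=> fA fB ltAB.
have [x xB xNA] : exists2 x, x \in B & v x \notin <<[seq v z | z in A]>>%VS.
  apply/exists_inP; apply: contraT; rewrite negb_exists_in => /forall_inP sBA.
  have /dimvS : (<<[seq v z | z in B]>> <= <<[seq v z | z in A]>>)%VS.
    by apply/span_subvP => _ /imageP[x xB ->]; have := sBA x xB; rewrite negbK.
  have [/eqP -> /eqP ->] := (fA, fB).
  by rewrite !size_map -!cardE leqNgt ltAB.
have xA : x \notin A by apply: contra xNA => xA; apply/memv_span/image_f.
by exists x; rewrite ?inE ?xA // /lin_indep free_imageU1 // xNA.
Qed.

Definition linear_matroid (F : fieldType) (V : vectType F) (T : finType) (v : T -> V) :
    matroid T :=
  Matroid (lin_indep0 v) (@lin_indep_sub _ _ _ v) (@lin_indep_aug _ _ _ v).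

Lemma card_le_dim (F : fieldType) (V : vectType F) (T : finType) (v : T -> V)
    (A : {set T}) (U : {vspace V}) :
  indep (linear_matroid v) A -> (forall x, x \in A -> v x \in U) ->
  (#|A| <= \dim U)%N.
Proof.
move=> /eqP; rewrite size_map -cardE => <- sAU; apply: dimvS.
by apply/span_subvP => _ /imageP[x xA ->]; apply: sAU.
Qed.

Lemma F2_neq0 (a : 'F_2) : a != 0 -> a = 1.
Proof. by case: a => [[|[|m]]] i //= _; apply: val_inj. Qed.

(** The only nonzero coefficient that w can have is 1. *)
Lemma F2_span_cons (V : vectType 'F_2) (u w : V) (L : {vspace V}) :
  u \in (<[w]> + L)%VS -> u \notin L -> u - w \in L.
Proof.
case/memv_addP=> _ /vlineP[k ->] [l lL ->]; have [->|/F2_neq0->] := eqVneq k 0.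
  by rewrite scale0r add0r lL.
by rewrite scale1r addrAC subrr add0r.
Qed.

(** Modulo the span L of Y, the vectors of c and d are both congruent to the sum
    of those of a and b, so they are congruent to each other, that is, c and d
    are parallel. *)
Lemma F2_linear_U24_free (V : vectType 'F_2) (T : finType) (v : T -> V) :
  U24_free (linear_matroid v).
Proof.
move=> Y a b c d cY; apply/negP=> qd.
have /andP[/= uq /and5P[/= aNY bNY cNY dNY _]] := U24_minor_uniq cY qd.
have [[ab ac ad] [bc bd cd]] := U24_minorP _ _ _ _ _ _ qd.
have sep x y : basis (linear_matroid v) (x |: (y |: Y)) ->
    v x \notin <<[seq v z | z in y |: Y]>>%VS.
  move=> bxy; have [nxy xNY _] := basis_pair_distinct cY bxy.
  case/andP: bxy; rewrite /= /lin_indep free_imageU1; first by case/andP.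
  by rewrite !inE negb_or nxy.
have inab x : v x \in <<[seq v z | z in a |: (b |: Y)]>>%VS.
  apply: contraT => xN; have [iab /eqP cab] := andP ab.
  have xNab : x \notin a |: (b |: Y).
    by apply: contra xN => xab; apply/memv_span/image_f.
  have : indep (linear_matroid v) (x |: (a |: (b |: Y))).
    by rewrite /= /lin_indep free_imageU1 // xN.
  by move/indep_card_le; rewrite cardsU1 xNab cab ltnn.
pose L := <<[seq v z | z in Y]>>%VS.
have diffab x : basis (linear_matroid v) (a |: (x |: Y)) ->
    basis (linear_matroid v) (b |: (x |: Y)) -> v x - v a - v b \in L.
  rewrite setUCA => /sep xa; rewrite setUCA => bx; have xb := sep _ _ bx.
  apply: F2_span_cons.
    rewrite -span_imageU1; apply: F2_span_cons xb.
    by rewrite -span_imageU1.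
  apply: contra xa => xaL; rewrite span_imageU1 -[v x](subrK (v a)) addrC.
  by apply: memv_add => //; apply: memv_line.
have := memvB (diffab c ac bc) (diffab d ad bd).
rewrite -[_ - v a - _]addrA -[v d - v a - _]addrA -opprD opprB addrA subrK => cdL.
have := sep _ _ cd; rewrite span_imageU1 -[v c](subrK (v d)) addrC.
by rewrite memv_add // memv_line.
Qed.

Lemma span_coord0 (F : fieldType) n (X : seq 'rV[F]_n) w j :
  w \in <<X>>%VS -> (forall u, u \in X -> u 0 j = 0) -> w 0 j = 0.
Proof.
move=> wX X0; rewrite (coord_span (X := in_tuple X) wX) summxE big1 // => i _.
by rewrite mxE X0 ?mulr0 // mem_nth.
Qed.

(** The coordinates of x in the basis B, as they would be over the field with
    two elements: for x outside B, the support is the part in B of the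
    fundamental circuit of x; for x in B it is x alone.  Indexing by the
    whole ground set, with zeros outside B, avoids enumerating B. *)
Definition fund_vec (F : fieldType) (T : finType) (M : matroid T) (B : {set T})
    (x : T) : 'rV[F]_#|T| :=
  \row_i ((enum_val i \in B) && basis M (x |: B :\ enum_val i))%:R.

Lemma fund_vecE (F : fieldType) (T : finType) (M : matroid T)
    (B : {set T}) x b :
  fund_vec F M B x 0 (enum_rank b) = ((b \in B) && basis M (x |: B :\ b))%:R.
Proof. by rewrite mxE enum_rankK. Qed.

Lemma basis_exchange_in (T : finType) (M : matroid T) (B : {set T})
    (bB : basis M B) x b :
  b \in B -> x \in B -> basis M (x |: B :\ b) = (x == b).
Proof.
move=> bB' xB; have [->|xb] := eqVneq x b; first by rewrite setD1K.
have -> : x |: B :\ b = B :\ b by apply/setUidPr; rewrite sub1set !inE xb.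
rewrite /basis -(basis_card bB) (cardsD1 b B) bB' -[X in X == _]add0n eqn_add2r.
by rewrite andbF.
Qed.

Lemma fund_vec_basis (F : fieldType) (T : finType) (M : matroid T)
    (B : {set T}) (bB : basis M B) x :
  x \in B -> fund_vec F M B x = delta_mx 0 (enum_rank x).
Proof.
move=> xB; apply/rowP=> i; rewrite -(enum_valK i) fund_vecE mxE eqxx /=.
rewrite (inj_eq enum_rank_inj) eq_sym.
have [iB|iNB] /= := boolP (_ \in B); first by rewrite basis_exchange_in // eq_sym.
by have [xi|//] := eqVneq x (enum_val i); rewrite -xi xB in iNB.
Qed.

(** The vectors of B are distinct unit vectors, so the span of a part A of B is
    read off from the support. *)
Lemma fund_vec_span (F : fieldType) (T : finType) (M : matroid T)
    (B : {set T}) (bB : basis M B) (A : {set T}) x :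
    A \subset B ->
  (fund_vec F M B x \in <<[seq fund_vec F M B z | z in A]>>%VS) =
    [forall b in B, basis M (x |: B :\ b) ==> (b \in A)].
Proof.
move=> sAB; apply/idP/forall_inP=> [xA b bB'|supp].
  apply/implyP=> bx; apply: contraT => bNA.
  have /eqP : fund_vec F M B x 0 (enum_rank b) = 0.
    apply: span_coord0 xA _ => _ /imageP[z zA ->].
    rewrite fund_vec_basis ?(subsetP sAB) // mxE (inj_eq enum_rank_inj) /=.
    by have [bz|//] := eqVneq b z; rewrite bz zA in bNA.
  by rewrite fund_vecE bB' bx oner_eq0.
rewrite [fund_vec F M B x]row_sum_delta; apply: memv_suml => i _.
have [->|nz] := eqVneq (fund_vec F M B x 0 i) 0; first by rewrite scale0r mem0v.
apply: memvZ; rewrite -(enum_valK i) in nz *; move: nz; rewrite fund_vecE.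
case iB: (_ \in B); last by rewrite eqxx.
case bx: (basis _ _); last by rewrite eqxx.
move=> _; have iA := implyP (supp _ iB) bx.
by rewrite -(fund_vec_basis F bB iB); apply/memv_span/image_f.
Qed.

Lemma fund_free (F : fieldType) (T : finType) (M : matroid T)
    (B : {set T}) (bB : basis M B) (A : {set T}) :
  A \subset B -> indep (linear_matroid (fund_vec F M B)) A.
Proof.
move: {2}#|A| (leqnn #|A|) => n; elim: n A => [|n IHn] A leA sAB.
  by move: leA; rewrite leqn0 cards_eq0 => /eqP->; apply: indep0.
have [->|/set0Pn[x xA]] := eqVneq A set0; first exact: indep0.
have xB := subsetP sAB x xA.
have sAx : A :\ x \subset B by apply: subset_trans sAB; apply: subsetDl.
rewrite -(setD1K xA) /= /lin_indep free_imageU1 ?inE ?eqxx // fund_vec_span //.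
apply/andP; split; last first.
  by apply: IHn => //; move: leA; rewrite (cardsD1 x) xA.
apply/negP=> /forall_inP/(_ x xB); rewrite basis_exchange_in // eqxx /=.
by rewrite !inE eqxx.
Qed.

Lemma fund_rank (F : fieldType) (T : finType) (M : matroid T)
    (B : {set T}) (bB : basis M B) :
  mrank (linear_matroid (fund_vec F M B)) = mrank M.
Proof.
apply/eqP; rewrite -(basis_card bB) eqn_leq indep_card_le ?fund_free // andbT.
have [Z bZ] := basis_exists (linear_matroid (fund_vec F M B)); rewrite -(basis_card bZ).
have [iZ _] := andP bZ.
apply: leq_trans (card_le_dim (U := <<[seq fund_vec F M B z | z in B]>>%VS) iZ _) _.
  move=> x _; rewrite fund_vec_span //.
  by apply/forall_inP=> b bB'; rewrite bB' implybT.
by apply: leq_trans (dim_span _) _; rewrite size_map -cardE.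
Qed.

(** Exchanging b for x keeps the vectors independent exactly when the
    coordinate of x at b is nonzero, and that is how the coordinates were
    chosen. Exchanges at B do not see the coefficients, so this holds over any
    field. *)
Lemma fund_agree (F : fieldType) (T : finType) (M : matroid T)
    (B : {set T}) (bB : basis M B) :
  agree_at M (linear_matroid (fund_vec F M B)) B.
Proof.
split=> //; first by rewrite /basis fund_free // (fund_rank F bB) (basis_card bB) eqxx.
move=> b x bB'; rewrite [RHS]/basis (fund_rank F bB).
have [xBb | xNBb] := boolP (x \in B :\ b).
  have -> : x |: B :\ b = B :\ b by apply/setUidPr; rewrite sub1set.
  rewrite /basis -(basis_card bB) (cardsD1 b B) bB' -[X in X == _]add0n eqn_add2r.
  by rewrite !andbF.
have -> : #|x |: B :\ b| = mrank M.
  by rewrite cardsU1 xNBb -(basis_card bB) (cardsD1 b B) bB'.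
rewrite eqxx andbT /= /lin_indep free_imageU1 // fund_vec_span ?subsetDl //.
have -> : free [seq fund_vec F M B z | z in B :\ b].
  by apply: fund_free; last exact: subsetDl.
rewrite andbT negb_forall_in.
apply/idP/exists_inP=> [bx|[c cB]]; first by exists b; rewrite // bx !inE eqxx.
by rewrite negb_imply !inE cB andbT negbK => /andP[bx /eqP<-].
Qed.

Lemma U24_free_binary (T : finType) (M : matroid T) : U24_free M -> binary M.
Proof.
move=> fM; have [B bB] := basis_exists M.
exists #|T|, (fund_vec 'F_2 M B).
exact: agree_indep fM (@F2_linear_U24_free _ _ _) (fund_agree 'F_2 bB).
Qed.

Theorem theorem4p3 (T : finType) (M : matroid T)
    (C : 'I_(corank M) -> {set T}) (hC : cycle_system M C) :
  binary M.
Proof. exact: U24_free_binary (cycle_system_U24_free hC). Qed.
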